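(* Let $R$ be a commutative ring and let $A=\bigoplus_{i\in\mathbb{Z}}A_i$ be a commutative, graded $R$-algebra with identity such that each $A_i$ is free of finite rank. For any connected finite graph $G$ with $n$ vertices, the chromatic homology $H^{\mathrm{Ch}}_A(G)$ is supported in homological gradings $0\leq i\leq n-1$; that is, its degree $i$ part vanishes unless $0\le i\le n-1$.
   Context: A finite graph $G=(V,E)$ consists of a finite set $V$ and a set $E$ of 2-element subsets of $V$. Fix an ordering $e_1,\dots,e_m$ of $E$. For $S\subseteq E$, $k(S)$ is the number of connected components of the spanning subgraph with vertex set $V$ and edge set $S$. The chromatic functor $F^{\mathrm{Ch}}=F^{\mathrm{Ch}}_{G,A}$ from the Boolean lattice $2^E$ (subsets of $E$ ordered by inclusion, viewed as a category) to graded $R$-modules with degree-preserving homomorphisms is given by: $F^{\mathrm{Ch}}(S)=A^{\otimes k(S)}$ (tensor product over $R$, one factor for each connected component of $S$); for a cover relation $S\lessdot S\cup\{e\}$, if $e$ joins two distinct components of $S$, then $F^{\mathrm{Ch}}(S\lessdot S\cup\{e\})$ multiplies the two tensor factors of $A$ corresponding to those components, and if $e$ completes a cycle, it is the identity map. Let $c(S\lessdot S\cup\{e_i\})=(-1)^{\#\{e_j\in S\,:\,j<i\}}$. The chromatic homology $H^{\mathrm{Ch}}_A(G)$ is the cohomology of the cochain complex with $C^k=\bigoplus_{|S|=k}F^{\mathrm{Ch}}(S)$ and differential $\delta^k=\sum_{S\lessdot T,\,|S|=k}c(S\lessdot T)F^{\mathrm{Ch}}(S\lessdot T)$; the homological grading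 is the index $k=|S|$. *)

(* Defs.v *)
From HB Require Import structures.
From mathcomp Require Import all_boot all_order all_algebra.
From mathcomp Require Import boolp.

Set Implicit Arguments.
Unset Strict Implicit.
Unset Printing Implicit Defensive.

Import Order.TTheory GRing.Theory Num.Theory.
Local Open Scope ring_scope.
Local Open Scope quotient_scope.

(* Rings and algebras may be zero, whence the Pz structures.  MathComp's *)
(* algebra structures exclude the zero algebra, so a commutative R-algebra is *)
(* given by its structure map phi : {rmorphism R -> A}; algmod phi is A with *)
(* the scalar multiplication r *: x = phi r * x. *)
Definition algmod (R A : comPzRingType) (phi : {rmorphism R -> A}) : Type := A.

Section AlgebraAsModule.
Variables (R A : comPzRingType) (phi : {rmorphism R -> A}).

HB.instance Definition _ := GRing.ComPzRing.copy (algmod phi) A.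

Definition alg_scale (r : R) (x : algmod phi) : algmod phi :=
  (phi r : A) * (x : A).

Fact alg_scaleA a b x : alg_scale a (alg_scale b x) = alg_scale (a * b) x.
Proof. by rewrite /alg_scale rmorphM mulrA. Qed.
Fact alg_scale1 : left_id 1 alg_scale.
Proof. by move=> x; rewrite /alg_scale rmorph1 mul1r. Qed.
Fact alg_scaleDr : right_distributive alg_scale +%R.
Proof. by move=> r x y; rewrite /alg_scale mulrDr. Qed.
Fact alg_scaleDl x : {morph alg_scale^~ x : a b / a + b}.
Proof. by move=> a b; rewrite /alg_scale rmorphD mulrDl. Qed.

HB.instance Definition _ := GRing.Zmodule_isLmodule.Build R (algmod phi)
  alg_scaleA alg_scale1 alg_scaleDr alg_scaleDl.

Lemma algmod_scalerAl (r : R) (x y : algmod phi) : r *: (x * y) = (r *: x) * y.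
Proof. exact: mulrA. Qed.

End AlgebraAsModule.

Section Grading.
Variables (R A : comPzRingType) (phi : {rmorphism R -> A}).
Variable Agr : int -> submodClosed (algmod phi).

Definition is_internal_direct_sum : Prop :=
  (forall x : algmod phi, exists (s : seq int) (f : int -> algmod phi),
     (forall i, f i \in Agr i) /\ x = \sum_(i <- s) f i) /\
  (forall (s : seq int) (f : int -> algmod phi),
     uniq s -> (forall i, f i \in Agr i) -> \sum_(i <- s) f i = 0 ->
     {in s, forall i, f i = 0}).

Definition is_graded_algebra : Prop :=
  [/\ is_internal_direct_sum,
      1 \in Agr 0 &
      forall i j x y, x \in Agr i -> y \in Agr j -> x * y \in Agr (i + j)].

End Grading.

Definition free_of_finite_rank (R : pzRingType) (M : lmodType R)
    (N : submodClosed M) : Prop :=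
  exists (n : nat) (b : 'I_n -> M), (forall k, b k \in N) /\
    forall x, x \in N -> exists! c : {ffun 'I_n -> R}, x = \sum_k c k *: b k.

(* The tensor power of M over R with one factor for each element of the finite *)
(* type I: formal R-linear combinations of families a : I -> M, i.e. sequences *)
(* of pairs (r, a), modulo the congruence generated by the module axioms and *)
(* multilinearity.  The universal property is tlift_pure and tlift_unique. *)
Section TensorPower.
Variables (R : comPzRingType) (M : lmodType R) (I : finType).
Implicit Types (a : {ffun I -> M}) (i : I) (r : R).

Definition upd a i (x : M) : {ffun I -> M} :=
  [ffun j => if j == i then x else a j].

Definition multilinear (N : lmodType R) (f : {ffun I -> M} -> N) : Prop :=
  (forall a i x y, f (upd a i (x + y)) = f (upd a i x) + f (upd a i y)) /\
  (forall a i r x, f (upd a i (r *: x)) = r *: f (upd a i x)).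

Definition fcomb : Type := seq (R * {ffun I -> M}).
HB.instance Definition _ := Choice.on fcomb.

Inductive tens_rel : fcomb -> fcomb -> Prop :=
| tens_refl s : tens_rel s s
| tens_sym s t : tens_rel s t -> tens_rel t s
| tens_trans s t u : tens_rel s t -> tens_rel t u -> tens_rel s u
| tens_cat s s' t t' :
    tens_rel s s' -> tens_rel t t' -> tens_rel (s ++ t) (s' ++ t')
| tens_catC s t : tens_rel (s ++ t) (t ++ s)
| tens_coef0 a : tens_rel [:: (0, a)] [::]
| tens_coefD r r' a : tens_rel [:: (r + r', a)] [:: (r, a); (r', a)]
| tens_add r a i x y :
    tens_rel [:: (r, upd a i (x + y))] [:: (r, upd a i x); (r, upd a i y)]
| tens_scale r a i r' x :
    tens_rel [:: (r, upd a i (r' *: x))] [:: (r * r', upd a i x)].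

Definition tens_eqv : rel fcomb := fun s t => `[< tens_rel s t >].

Fact tens_eqv_class : equiv_class_of tens_eqv.
Proof.
split.
- by move=> s; apply/asboolP/tens_refl.
- by move=> s t; apply/asboolP/asboolP; apply: tens_sym.
- by move=> t s u /asboolP ? /asboolP ?; apply/asboolP; apply: tens_trans; eassumption.
Qed.

Canonical tens_equiv := EquivRelPack tens_eqv_class.
Canonical tens_encModRel := defaultEncModRel tens_eqv.

Definition tpow := {eq_quot tens_eqv}.
HB.instance Definition _ : EqQuotient fcomb tens_eqv tpow := EqQuotient.on tpow.
HB.instance Definition _ := Choice.on tpow.

Lemma tpow_eqP (s t : fcomb) : tens_rel s t <-> \pi_tpow s = \pi_tpow t.
Proof.
split; first by move=> h; apply/eqmodP/asboolP.
by move/eqmodP/asboolP.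
Qed.

Lemma tens_repr s : tens_rel (repr (\pi_tpow s)) s.
Proof. by apply/tpow_eqP; rewrite reprK. Qed.

Lemma tpowW (P : tpow -> Prop) : (forall s, P (\pi_tpow s)) -> forall x, P x.
Proof. by move=> h x; rewrite -[x]reprK; apply: h. Qed.

Definition fscale r (s : fcomb) : fcomb := [seq (r * p.1, p.2) | p <- s].

Fact fscale_rel r s t : tens_rel s t -> tens_rel (fscale r s) (fscale r t).
Proof.
elim=> {s t}.
- by move=> s; apply: tens_refl.
- by move=> s t _; apply: tens_sym.
- by move=> s t u _ h1 _; apply: tens_trans.
- by move=> s s' t t' _ h1 _ h2; rewrite /fscale !map_cat; apply: tens_cat.
- by move=> s t; rewrite /fscale !map_cat; apply: tens_catC.
- by move=> a; rewrite /fscale /= mulr0; apply: tens_coef0.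
- by move=> r1 r2 a; rewrite /fscale /= mulrDr; apply: tens_coefD.
- by move=> r1 a i x y; apply: tens_add.
- by move=> r1 a i r2 x; rewrite /fscale /= mulrA; apply: tens_scale.
Qed.

Definition tzero : tpow := \pi_tpow ([::] : fcomb).
Definition tadd (x y : tpow) : tpow := \pi_tpow (repr x ++ repr y : fcomb).
Definition tscale r (x : tpow) : tpow := \pi_tpow (fscale r (repr x)).
Definition topp := tscale (-1).

Fact pi_tadd s t : tadd (\pi_tpow s) (\pi_tpow t) = \pi_tpow (s ++ t : fcomb).
Proof. by apply/tpow_eqP/tens_cat; apply: tens_repr. Qed.
Fact pi_tscale r s : tscale r (\pi_tpow s) = \pi_tpow (fscale r s).
Proof. exact/tpow_eqP/fscale_rel/tens_repr. Qed.

Fact taddA : associative tadd.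
Proof.
move=> x y z; elim/tpowW: x => s; elim/tpowW: y => t; elim/tpowW: z => u.
by rewrite !pi_tadd catA.
Qed.
Fact taddC : commutative tadd.
Proof.
move=> x y; elim/tpowW: x => s; elim/tpowW: y => t.
by rewrite !pi_tadd; apply/tpow_eqP/tens_catC.
Qed.
Fact tadd0 : left_id tzero tadd.
Proof. by move=> x; elim/tpowW: x => s; rewrite /tzero pi_tadd. Qed.

Fact fscaleDl_rel r r' s :
  tens_rel (fscale (r + r') s) (fscale r s ++ fscale r' s).
Proof.
elim: s => [|[c a] s IHs] /=; first exact: tens_refl.
rewrite -cat1s -[_ :: (_ ++ _)]cat1s.
apply: tens_trans (tens_cat _ IHs) _; first by rewrite mulrDl; apply: tens_coefD.
rewrite -[[:: _; _]]/([:: (r * c, a)] ++ [:: (r' * c, a)]) -!catA.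
apply: tens_cat; first exact: tens_refl.
rewrite -[_ :: fscale r' s]cat1s !catA.
by apply: tens_cat; [apply: tens_catC | apply: tens_refl].
Qed.

Fact fscale0_rel s : tens_rel (fscale 0 s) [::].
Proof.
elim: s => [|[c a] s IHs] /=; first exact: tens_refl.
rewrite -cat1s -[[::]]/([::] ++ [::]).
by apply: tens_cat => //; rewrite mul0r; apply: tens_coef0.
Qed.

Fact fscale1 s : fscale 1 s = s.
Proof. by elim: s => [//|[c a] s IHs] /=; rewrite mul1r IHs. Qed.

Fact taddN : left_inverse tzero topp tadd.
Proof.
move=> x; elim/tpowW: x => s; rewrite /topp pi_tscale pi_tadd; apply/tpow_eqP.
rewrite -{2}[s]fscale1; apply: tens_trans (tens_sym (fscaleDl_rel _ _ _)) _.
by rewrite addNr; apply: fscale0_rel.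
Qed.

HB.instance Definition _ := GRing.isZmodule.Build tpow taddA taddC tadd0 taddN.

Fact tscaleA r r' x : tscale r (tscale r' x) = tscale (r * r') x.
Proof.
elim/tpowW: x => s; rewrite !pi_tscale /fscale -map_comp.
by congr (\pi _); apply: eq_map => p /=; rewrite mulrA.
Qed.
Fact tscale1 : left_id 1 tscale.
Proof. by move=> x; elim/tpowW: x => s; rewrite pi_tscale fscale1. Qed.
Fact tscaleDr : right_distributive tscale +%R.
Proof.
move=> r x y; elim/tpowW: x => s; elim/tpowW: y => t.
by rewrite /GRing.add /= pi_tadd !pi_tscale pi_tadd /fscale map_cat.
Qed.
Fact tscaleDl x : {morph tscale^~ x : r r' / r + r'}.
Proof.
elim/tpowW: x => s r r'; rewrite [RHS]/GRing.add /= !pi_tscale pi_tadd.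
exact/tpow_eqP/fscaleDl_rel.
Qed.

HB.instance Definition _ := GRing.Zmodule_isLmodule.Build R tpow
  tscaleA tscale1 tscaleDr tscaleDl.

Definition pure a : tpow := \pi_tpow ([:: (1, a)] : fcomb).

Lemma tpow_piE s : \pi_tpow s = \sum_(p <- s) p.1 *: pure p.2.
Proof.
elim: s => [|[r a] s IHs]; first by rewrite big_nil.
rewrite big_cons -IHs /= -cat1s -pi_tadd; congr (_ + _).
by rewrite /pure [RHS]pi_tscale /fscale /= mulr1.
Qed.

Lemma pure_multilinear : multilinear pure.
Proof.
split=> [a i x y|a i r x]; rewrite /pure.
  by rewrite [RHS]pi_tadd; apply/tpow_eqP/tens_add.
rewrite [RHS]pi_tscale /fscale /= mulr1; apply/tpow_eqP.
by apply: tens_trans (tens_scale _ _ _ _ _) _; rewrite mul1r; apply: tens_refl.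
Qed.

Section Lift.
Variables (N : lmodType R) (f : {ffun I -> M} -> N).

Definition fcomb_eval (s : fcomb) : N := \sum_(p <- s) p.1 *: f p.2.
Definition tlift (x : tpow) : N := fcomb_eval (repr x).

Hypothesis f_ml : multilinear f.

Lemma fcomb_eval_rel s t : tens_rel s t -> fcomb_eval s = fcomb_eval t.
Proof.
rewrite /fcomb_eval; case: f_ml => fD fZ; elim=> {s t} //.
- by move=> s t u _ -> _ ->.
- by move=> s s' t t' _ h1 _ h2; rewrite !big_cat /= h1 h2.
- by move=> s t; rewrite !big_cat /= addrC.
- by move=> a; rewrite big_seq1 big_nil scale0r.
- by move=> r r' a; rewrite !big_cons !big_nil !addr0 /= scalerDl.
- by move=> r a i x y; rewrite !big_cons !big_nil !addr0 /= fD scalerDr.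
- by move=> r a i r' x; rewrite !big_seq1 /= fZ scalerA.
Qed.

Lemma tlift_pi s : tlift (\pi_tpow s) = \sum_(p <- s) p.1 *: f p.2.
Proof. exact/fcomb_eval_rel/tens_repr. Qed.

Lemma tlift_pure a : tlift (pure a) = f a.
Proof. by rewrite tlift_pi big_seq1 scale1r. Qed.

Lemma tlift_linear : linear tlift.
Proof.
move=> r x y; elim/tpowW: x => s; elim/tpowW: y => t.
have -> : r *: \pi_tpow s + \pi_tpow t = \pi_tpow (fscale r s ++ t : fcomb).
  by rewrite -pi_tadd -pi_tscale.
rewrite !tlift_pi big_cat big_map scaler_sumr /=; congr (_ + _).
by apply: eq_bigr => p _; rewrite scalerA.
Qed.

Lemma tlift_unique (g : {linear tpow -> N}) :
  (forall a, g (pure a) = f a) -> g =1 tlift.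
Proof.
move=> gf x; elim/tpowW: x => s; rewrite tlift_pi tpow_piE linear_sum.
by apply: eq_bigr => p _; rewrite linearZ gf.
Qed.

End Lift.

End TensorPower.

Arguments pure {R M I} a.

(* The map of tensor powers of A which multiplies together, for each j, the *)
(* factors indexed by the fibre of p over j. *)
Section TensorMultiplication.
Variables (R A : comPzRingType) (phi : {rmorphism R -> A}).
Local Notation M := (algmod phi).
Variables (I J : finType) (p : I -> J).

Definition fibre_prod (a : {ffun I -> M}) : {ffun J -> M} :=
  [ffun j => \prod_(i | p i == j) a i].

Definition tmul : tpow M I -> tpow M J := tlift (fun a => pure (fibre_prod a)).

Fact fibre_prod_upd a i x : fibre_prod (upd a i x) =
  upd (fibre_prod a) (p i) (x * \prod_(k | (p k == p i) && (k != i)) a k).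
Proof.
apply/ffunP=> j; rewrite !ffunE; case: eqP => [->|/eqP ji].
  rewrite (bigD1 i) //= ffunE eqxx; congr (_ * _).
  by apply: eq_bigr => k /andP[_ /negPf ki]; rewrite ffunE ki.
apply: eq_bigr => k /eqP pk; rewrite ffunE; case: eqP => // ki.
by rewrite -pk ki eqxx in ji.
Qed.

Fact fibre_prod_multilinear : multilinear (fun a => pure (fibre_prod a)).
Proof.
have [pD pZ] := pure_multilinear M J.
split=> [a i x y|a i r x]; rewrite !fibre_prod_upd; first by rewrite mulrDl pD.
by rewrite -algmod_scalerAl pZ.
Qed.

Lemma tmul_pure a : tmul (pure a) = pure (fibre_prod a).
Proof. exact: (tlift_pure fibre_prod_multilinear). Qed.

HB.instance Definition _ := GRing.isLinear.Build R (tpow M I) (tpow M J) _ tmul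
  (tlift_linear fibre_prod_multilinear).

End TensorMultiplication.

Arguments tmul {R A} phi {I J} p x.

Section DirectSum.
Variables (R : pzRingType) (I : finType) (M : I -> lmodType R).

Definition dirsum : Type := {dffun forall i : I, M i}.
HB.instance Definition _ := Choice.on dirsum.
Implicit Types x y : dirsum.

Definition ds_mk (f : forall i, M i) : dirsum := finfun f.
Definition ds_add x y : dirsum := ds_mk (fun i => x i + y i).
Definition ds_scale (r : R) x : dirsum := ds_mk (fun i => r *: x i).

Lemma ds_mkE f i : ds_mk f i = f i. Proof. by rewrite ffunE. Qed.
Lemma dsP x y : (forall i, x i = y i) -> x = y. Proof. by move/ffunP. Qed.

Fact ds_addA : associative ds_add.
Proof. by move=> x y z; apply: dsP => i; rewrite !ds_mkE addrA. Qed.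
Fact ds_addC : commutative ds_add.
Proof. by move=> x y; apply: dsP => i; rewrite !ds_mkE addrC. Qed.
Fact ds_add0 : left_id (ds_mk (fun=> 0)) ds_add.
Proof. by move=> x; apply: dsP => i; rewrite !ds_mkE add0r. Qed.
Fact ds_addN : left_inverse (ds_mk (fun=> 0)) (fun x => ds_mk (fun i => - x i)) ds_add.
Proof. by move=> x; apply: dsP => i; rewrite !ds_mkE addNr. Qed.
HB.instance Definition _ :=
  GRing.isZmodule.Build dirsum ds_addA ds_addC ds_add0 ds_addN.

Fact ds_scaleA a b x : ds_scale a (ds_scale b x) = ds_scale (a * b) x.
Proof. by apply: dsP => i; rewrite !ds_mkE scalerA. Qed.
Fact ds_scale1 : left_id 1 ds_scale.
Proof. by move=> x; apply: dsP => i; rewrite !ds_mkE scale1r. Qed.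
Fact ds_scaleDr : right_distributive ds_scale +%R.
Proof. by move=> r x y; apply: dsP => i; rewrite !ds_mkE scalerDr. Qed.
Fact ds_scaleDl x : {morph ds_scale^~ x : a b / a + b}.
Proof. by move=> a b; apply: dsP => i; rewrite !ds_mkE scalerDl. Qed.
HB.instance Definition _ := GRing.Zmodule_isLmodule.Build R dirsum
  ds_scaleA ds_scale1 ds_scaleDr ds_scaleDl.

Lemma dirsumDE x y i : (x + y) i = x i + y i. Proof. exact: ds_mkE. Qed.
Lemma dirsumZE r x i : (r *: x) i = r *: x i. Proof. exact: ds_mkE. Qed.

End DirectSum.

(* The cohomology ker g / im f of U --f--> V --g--> W. *)
Section Cohomology.
Variables (R : pzRingType) (U V W : lmodType R).
Variables (f : {linear U -> V}) (g : {linear V -> W}).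

Definition in_ker : {pred V} := [pred x | g x == 0].
Fact in_ker_closed : GRing.subsemimod_closed in_ker.
Proof.
split; first split.
- by rewrite inE linear0.
- by move=> x y; rewrite !inE linearD => /eqP-> /eqP->; rewrite addr0.
- by move=> r x; rewrite !inE linearZZ => /eqP->; rewrite scaler0.
Qed.
HB.instance Definition _ := GRing.isSubmodClosed.Build R V in_ker in_ker_closed.

Definition cocycles : Type := {x : V | x \in in_ker}.
HB.instance Definition _ := SubChoice.on cocycles.
HB.instance Definition _ := [SubChoice_isSubLmodule of cocycles by <:].

Definition coboundaries : {pred cocycles} :=
  [pred x | `[< exists u, f u = val x >]].
Fact coboundaries_closed : GRing.subsemimod_closed coboundaries.
Proof.
split; first split.
- by apply/asboolP; exists 0; rewrite !linear0.
- move=> x y /asboolP[u hu] /asboolP[v hv]; apply/asboolP.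
  by exists (u + v); rewrite linearD hu hv.
- move=> r x /asboolP[u hu]; apply/asboolP.
  by exists (r *: u); rewrite linearZZ hu.
Qed.
HB.instance Definition _ :=
  GRing.isSubmodClosed.Build R cocycles coboundaries coboundaries_closed.

Definition cohomology := {ideal_quot coboundaries}.
HB.instance Definition _ := GRing.Zmodule.on cohomology.

Lemma cohomologyW (P : cohomology -> Prop) :
  (forall x : cocycles, P (\pi_cohomology x)) -> forall x, P x.
Proof. by move=> h x; rewrite -[x]reprK; apply: h. Qed.

Definition coh_scale (r : R) (x : cohomology) : cohomology :=
  \pi_cohomology (r *: repr x : cocycles).

Fact pi_coh_scale r (x : cocycles) :
  coh_scale r (\pi_cohomology x) = \pi_cohomology (r *: x).
Proof.
apply/eqP; rewrite -Quotient.idealrBE -scalerBr rpredZ //.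
by rewrite Quotient.idealrBE reprK.
Qed.
Fact coh_scaleA a b x : coh_scale a (coh_scale b x) = coh_scale (a * b) x.
Proof. by elim/cohomologyW: x => x; rewrite !pi_coh_scale scalerA. Qed.
Fact coh_scale1 : left_id 1 coh_scale.
Proof. by move=> x; elim/cohomologyW: x => x; rewrite pi_coh_scale scale1r. Qed.
Fact coh_scaleDr : right_distributive coh_scale +%R.
Proof.
move=> r x y; elim/cohomologyW: x => x; elim/cohomologyW: y => y.
by rewrite -raddfD !pi_coh_scale scalerDr raddfD.
Qed.
Fact coh_scaleDl x : {morph coh_scale^~ x : a b / a + b}.
Proof. by elim/cohomologyW: x => x a b; rewrite !pi_coh_scale scalerDl raddfD. Qed.
HB.instance Definition _ := GRing.Zmodule_isLmodule.Build R cohomology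
  coh_scaleA coh_scale1 coh_scaleDr coh_scaleDl.

End Cohomology.

Record finite_graph := FiniteGraph {
  vertex :> finType;
  edges : {set {set vertex}};
  edges_card2 : forall e, e \in edges -> #|e| = 2
}.

Section Components.
Variable V : finType.
Implicit Types (S T : {set {set V}}) (v : V).

Definition adj S : rel V := fun u v => [set u; v] \in S.

Definition comps S : {set {set V}} :=
  equivalence_partition (connect (adj S)) [set: V].

Fact connect_adj_equiv S : {in [set: V] & &, equivalence_rel (connect (adj S))}.
Proof.
have /same_connect sc : connect_sym (adj S).
  by apply: sym_connect_sym => u v; rewrite /adj setUC.
by move=> x y z _ _ _; split=> [|/sc].
Qed.

Fact comps_partition S : partition (comps S) [set: V].
Proof. exact/equivalence_partitionP/connect_adj_equiv. Qed.

Definition component S : finType := {c : {set V} | c \in comps S}.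

Fact comp_of_subproof S v : pblock (comps S) v \in comps S.
Proof. by rewrite pblock_mem // (cover_partition (comps_partition S)) inE. Qed.
Definition comp_of S v : component S :=
  Sub (pblock (comps S) v) (comp_of_subproof S v).

Fact comp_inhabited S (c : component S) : exists v, v \in val c.
Proof.
apply/set0Pn; apply: contraTneq (valP c) => ->.
by case/and3P: (comps_partition S).
Qed.

(* For S a subset of T, the component of T which contains the component c of S. *)
Definition merge_comp S T (c : component S) : component T :=
  comp_of T (xchoose (comp_inhabited c)).

Lemma merge_comp_sub S T (c : component S) :
  S \subset T -> val c \subset val (merge_comp T c).
Proof.
move=> sST; rewrite /merge_comp; set v := xchoose _.
have vc : v \in val c by apply: xchooseP.
have cE : val c = pblock (comps S) v.
  by rewrite (def_pblock _ (valP c) vc) //; case/and3P: (comps_partition S).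
have eS := @connect_adj_equiv S; have eT := @connect_adj_equiv T.
apply/subsetP=> w; rewrite cE SubK !pblock_equivalence_partition ?inE //.
apply: connect_sub => x y xy; apply: connect1; exact: (subsetP sST).
Qed.

Lemma merge_comp_id S T (c : component S) :
  comps S = comps T -> val (merge_comp T c) = val c.
Proof.
move=> eST; rewrite SubK -eST (def_pblock _ (valP c) (xchooseP _)) //.
by case/and3P: (comps_partition S).
Qed.

End Components.

Definition connected_graph (G : finite_graph) : bool := #|comps (edges G)| == 1%N.

(* es lists the edges e_1, ..., e_m of G in the chosen order. *)
Definition edge_ordering (G : finite_graph) (es : seq {set G}) : Prop :=
  uniq es /\ es =i edges G.

Section ChromaticHomology.
Variables (R A : comPzRingType) (phi : {rmorphism R -> A}).
Variables (G : finite_graph) (es : seq {set G}).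
Implicit Types (S T : {set {set G}}) (e : {set G}).

Definition chromF S : lmodType R := tpow (algmod phi) (component S).

(* When T is S plus one edge: if the edge joins two components of S, merge_comp *)
(* identifies exactly those two and chromF_map multiplies their tensor factors; *)
(* if it completes a cycle, S and T have the same components, merge_comp is the *)
(* identity on them (merge_comp_id), and chromF_map is the identity. *)
Definition chromF_map S T : {linear chromF S -> chromF T} :=
  tmul phi (@merge_comp G S T).

Definition incidence_sign S e : R :=
  (-1) ^+ #|[set f in S | (index f es < index e es)%N]|.

Definition cells (k : int) : finType :=
  {S : {set {set G}} | (S \subset edges G) && (#|S|%:Z == k)}.

Definition cochains (k : int) : lmodType R :=
  @dirsum R (cells k) (fun B : cells k => chromF (val B)).

(* The differential in degree k is the case l = k + 1; a free target degree *)
(* avoids casting along (k - 1) + 1 = k. *)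
Definition delta (k l : int) (x : cochains k) : cochains l :=
  ds_mk (fun D : cells l =>
    \sum_(B : cells k)
      \sum_(e : {set G} | (e \notin val B) && (val D == e |: val B))
        incidence_sign (val B) e *: chromF_map (val B) (val D) (x B)).

Fact delta_linear k l : linear (@delta k l).
Proof.
move=> r x y; apply: dsP => T; rewrite dirsumDE dirsumZE !ds_mkE.
rewrite scaler_sumr -big_split /=; apply: eq_bigr => S _.
rewrite scaler_sumr -big_split /=; apply: eq_bigr => e _.
by rewrite dirsumDE dirsumZE linearP scalerDr !scalerA mulrC.
Qed.
HB.instance Definition _ k l :=
  GRing.isLinear.Build R (cochains k) (cochains l) _ (@delta k l) (@delta_linear k l).

Definition chromatic_homology (i : int) : lmodType R :=
  cohomology (@delta (i - 1) i) (@delta i (i + 1)).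

End ChromaticHomology.

(* Main.v *)
(* Fix the edge order.  Say that the k-th edge is active for S if its end points *)
(* are already connected by the edges of S that come after it, i.e. if S contains *)
(* a broken circuit with missing edge e_k.  A set S without active edges is *)
(* acyclic, so it has at most n - 1 elements; if S has active edges, toggling the *)
(* first one e changes neither the first active edge nor the components, so that *)
(* the structure map S -> S + e is an isomorphism.  Active edges stay active in *)
(* supersets, hence the cochains supported on the sets with an active edge among *)
(* the first k edges form a subcomplex, and the toggling matching contracts each *)
(* layer of this filtration.  All cells of degree at least n lie in the *)
(* filtration, so cocycles there are coboundaries. *)

Require Import Defs.
From mathcomp Require Import all_boot all_order all_algebra.
From mathcomp Require Import boolp.

Import Order.TTheory GRing.Theory Num.Theory.
Local Open Scope ring_scope.

(** The toggling matching acts as an explicit homotopy on families [x S] indexed by edge sets of all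
    sizes at once. [diff_exact] removes one edge index at a time: a cocycle vanishing on the sets
    with no active edge among the first [k + 1] differs by a coboundary from one vanishing on the
    sets with none among the first [k]; for [k = 0] these are all sets. The structure maps enter
    through functoriality ([chromF_map_comp]) and invertibility when components agree
    ([chromF_mapK]). By [idle_card] a set without active edges has fewer than [n] elements, so a
    cochain of degree at least [n] vanishes there; [delta_diff] carries the result back to the
    graded complex. *)

(** * Functoriality of tensor multiplication *)

Section TensorMultiplicationTheory.
Variables (R A : comPzRingType) (phi : {rmorphism R -> A}).

Lemma tpow_linear_ext (M : lmodType R) (I : finType) (N : lmodType R)
    (f g : {linear tpow M I -> N}) :
  (forall a, f (pure a) = g (pure a)) -> f =1 g.
Proof.
move=> fg x; elim/tpowW: x => s; rewrite tpow_piE !linear_sum.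
by apply: eq_bigr => p _; rewrite !linearZ fg.
Qed.

Lemma tmul_comp (I J K : finType) (p : I -> J) (q : J -> K) x :
  tmul phi q (tmul phi p x) = tmul phi (q \o p) x.
Proof.
have : tmul phi q \o tmul phi p =1 tmul phi (q \o p); last by apply.
apply: tpow_linear_ext => a /=; rewrite !tmul_pure; congr pure; apply/ffunP=> k; rewrite !ffunE.
rewrite (partition_big p (fun j => q j == k)) //=; apply: eq_bigr => j /eqP qj.
rewrite ffunE; apply: eq_bigl => i.
by case: eqP => [->|]; rewrite ?andbF // qj eqxx.
Qed.

Lemma tmul_id (I : finType) (p : I -> I) x : p =1 id -> tmul phi p x = x.
Proof.
move=> pid; have : tmul phi p =1 idfun; last by apply.
apply: tpow_linear_ext => a /=; rewrite tmul_pure; congr pure; apply/ffunP=> k; rewrite ffunE.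
by rewrite (big_pred1 k) // => i; rewrite pid.
Qed.

Lemma eq_tmul (I J : finType) (p q : I -> J) x :
  p =1 q -> tmul phi p x = tmul phi q x.
Proof.
move=> pq; have : tmul phi p =1 tmul phi q; last by apply.
apply: tpow_linear_ext => a /=; rewrite !tmul_pure; congr pure.
by apply/ffunP=> k; rewrite !ffunE; apply: eq_bigl => i; rewrite pq.
Qed.

End TensorMultiplicationTheory.

(** * Components and redundant edges *)

Section ComponentsTheory.
Context {V : finType}.
Implicit Types (S T U : {set {set V}}) (e : {set V}).

Lemma comp_of_eq {S} {c : component S} {v} : v \in val c -> comp_of S v = c.
Proof.
move=> vc; apply: val_inj; rewrite SubK (def_pblock _ (valP c) vc) //.
by case/and3P: (comps_partition S).
Qed.

Lemma mem_comp_of S v : v \in val (comp_of S v).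
Proof. by rewrite SubK mem_pblock (cover_partition (comps_partition S)) inE. Qed.

Lemma comp_of_connect S u v : (comp_of S u == comp_of S v) = connect (adj S) u v.
Proof.
rewrite -(inj_eq val_inj) !SubK eq_pblock ?(cover_partition (comps_partition S)) ?inE //.
- by rewrite pblock_equivalence_partition ?inE //; apply: connect_adj_equiv.
- by case/and3P: (comps_partition S).
Qed.

Lemma merge_comp_of S T v : S \subset T -> merge_comp T (comp_of S v) = comp_of T v.
Proof.
move=> sST; apply/esym/comp_of_eq.
exact/(subsetP (merge_comp_sub _ sST))/mem_comp_of.
Qed.

Lemma comp_ofP {S} (c : component S) : exists v, c = comp_of S v.
Proof. by have [v vc] := comp_inhabited c; exists v; rewrite (comp_of_eq vc). Qed.

Lemma merge_comp_comp S T U (c : component S) : S \subset T -> T \subset U ->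
  merge_comp U (merge_comp T c) = merge_comp U c.
Proof.
move=> sST sTU; have [v ->] := comp_ofP c.
by rewrite !merge_comp_of // (subset_trans sST).
Qed.

Lemma merge_compK S T : comps S = comps T ->
  cancel (@merge_comp V S T) (@merge_comp V T S).
Proof. by move=> eST c; apply: val_inj; rewrite !merge_comp_id. Qed.

Definition redundant S e : Prop :=
  forall u v, e = [set u; v] -> connect (adj S) u v.

Lemma redundantS S T e : S \subset T -> redundant S e -> redundant T e.
Proof.
move=> /subsetP sST rS u v /rS; apply: connect_sub => x y xy.
exact/connect1/sST.
Qed.

Lemma connect_redundant S e : redundant S e ->
  subrel (connect (adj (e |: S))) (connect (adj S)).
Proof.
move=> rS; apply: connect_sub => x y; rewrite /adj in_setU1 => /orP[/eqP/esym/rS //|].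
exact: connect1.
Qed.

Lemma comps_redundant S e : redundant S e -> comps (e |: S) = comps S.
Proof.
move=> rS; have sS: S \subset e |: S by apply: subsetUr.
have eqc : connect (adj (e |: S)) =2 connect (adj S).
  move=> x y; apply/idP/idP; first exact: connect_redundant.
  by apply: connect_sub => {x y} x y xy; apply/connect1/(subsetP sS).
apply: eq_imset => x; apply/setP=> y; rewrite !inE; exact: eqc.
Qed.

Lemma card_component S : #|component S| = #|comps S|.
Proof. by rewrite card_sig; apply: eq_card. Qed.

(** Merging maps the components of [S] onto those of the larger set. If the count did not drop, this
    surjection would be injective, yet it identifies the components of [u] and [v]. *)
Lemma ltn_comps S u v : ~~ connect (adj S) u v ->
  (#|comps ([set u; v] |: S)| < #|comps S|)%N.
Proof.
set T := _ |: S => nuv; have sS: S \subset T by apply: subsetUr.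
rewrite -!card_component ltnNge; apply/negP => leST.
have surj (c : component T) : exists b : component S, merge_comp T b == c.
  by have [w ->] := comp_ofP c; exists (comp_of S w); rewrite merge_comp_of.
pose g c := xchoose (surj c).
have gK : cancel g (@merge_comp V S T) by move=> c; apply/eqP/(xchooseP (surj c)).
have gbij := inj_card_bij (can_inj gK) leST.
have /inj_eq inj : injective (@merge_comp V S T) := bij_inj (bij_can_bij gbij gK).
case/negP: nuv; rewrite -comp_of_connect -inj !merge_comp_of // comp_of_connect.
by apply: connect1; rewrite /adj setU11.
Qed.

End ComponentsTheory.

(** * The signed differential squares to zero *)

(** The injective rank [r] orders each pair, so every term cancels against its swap without any
    division by 2. *)
Lemma sum_antisym (N : zmodType) (I : finType) (P : pred I) (r : I -> nat)
    (h : I -> I -> N) :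
  {in P &, injective r} -> (forall a b, P a -> P b -> a != b -> h a b = - h b a) ->
  \sum_(a | P a) \sum_(b | P b && (b != a)) h a b = 0.
Proof.
move=> rinj hN.
have -> : \sum_(a | P a) \sum_(b | P b && (b != a)) h a b =
    \sum_(a | P a) \sum_(b | P b && (r b < r a)%N) h a b +
    \sum_(a | P a) \sum_(b | P b && (r a < r b)%N) h a b.
  rewrite -big_split; apply: eq_bigr => a Pa.
  rewrite (bigID (fun b => (r b < r a)%N)) /=; congr (_ + _).
    apply: eq_bigl => b; rewrite -andbA; congr andb; rewrite andbC.
    by case: ltnP => //= h1; apply: contraTneq h1 => ->; rewrite ltnn.
  apply: eq_bigl => b; rewrite -andbA; case Pb: (P b) => //=.
  by rewrite -leqNgt ltn_neqAle (inj_in_eq rinj) // eq_sym.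
rewrite [X in _ + X](exchange_big_dep P) //=; last by move=> a b _ /andP[].
rewrite -big_split big1 // => a Pa /=.
rewrite [X in _ + X](eq_bigl (fun b => P b && (r b < r a)%N)); last first.
  by move=> b; rewrite Pa.
rewrite -big_split big1 // => b /andP[Pb h1] /=.
by rewrite (hN _ _ Pa Pb) ?addNr //; apply: contraTneq h1 => ->; rewrite ltnn.
Qed.

Section BooleanLatticeComplex.
Variables (R : comPzRingType) (G : finite_graph) (es : seq {set G}).
Hypothesis es_ordering : edge_ordering es.
Implicit Types (S T U : {set {set G}}) (e f : {set G}) (k l : nat).

Variables (F : {set {set G}} -> lmodType R) (m : forall S T, {linear F S -> F T}).
Hypothesis m_comp : forall S T U x, S \subset T -> T \subset U ->
  m T U (m S T x) = m S U x.
Hypothesis mK : forall S T, comps S = comps T -> cancel (m S T) (m T S).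

Local Notation sgn := (incidence_sign R es).

Lemma incidence_sign_sqr S e : sgn S e * sgn S e = 1.
Proof. by rewrite -expr2 sqrr_sign. Qed.

Lemma incidence_signU1 S e f : f \notin S ->
  sgn (f |: S) e = (-1) ^+ (index f es < index e es)%N * sgn S e.
Proof.
move=> fS; rewrite /incidence_sign -exprD; congr (_ ^+ _).
have -> : [set g in f |: S | (index g es < index e es)%N] =
    [set g in [set f] | (index g es < index e es)%N] :|:
    [set g in S | (index g es < index e es)%N].
  by apply/setP=> g; rewrite !inE andb_orl.
rewrite cardsU -[RHS]subn0; congr (_ - _)%N.
  congr (_ + _)%N; case: ltnP => h.
    by apply/eqP/cards1P; exists f; apply/setP=> g; rewrite !inE; case: eqP => // ->.
  apply/eqP; rewrite cards_eq0; apply/eqP/setP=> g; rewrite !inE.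
  by case: eqP => // ->; rewrite ltnNge h.
apply/eqP; rewrite cards_eq0; apply/eqP/setP=> g; rewrite !inE.
by case: eqP => [->|]; rewrite ?(negPf fS) ?andbF.
Qed.

(** Indexing by plain sets, with no fixed size, avoids casts between degrees. *)
Definition diff (x : forall S, F S) T : F T :=
  \sum_(e in T) sgn (T :\ e) e *: m (T :\ e) T (x (T :\ e)).

Lemma diffB x y T : diff (fun S => x S - y S) T = diff x T - diff y T.
Proof.
rewrite /diff -sumrB; apply: eq_bigr => e _.
by rewrite linearB scalerBr.
Qed.

Lemma index_edge_inj : {in edges G &, injective (index^~ es)}.
Proof.
have [_ esE] := es_ordering; move=> e f; rewrite -!esE => eE fE.
exact: index_inj.
Qed.

Lemma diff_diff x T : T \subset edges G -> diff (diff x) T = 0.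
Proof.
move=> /subsetP sT.
pose h e f : F T := (sgn (T :\ e) e * sgn (T :\ e :\ f) f) *:
  m (T :\ e :\ f) T (x (T :\ e :\ f)).
transitivity (\sum_(e in T) \sum_(f | (f \in T) && (f != e)) h e f).
  apply: eq_bigr => e eT; rewrite /diff linear_sum scaler_sumr.
  apply: eq_big => [f|f fT]; first by rewrite !inE andbC.
  by rewrite linearZZ scalerA m_comp // subD1set.
apply: (@sum_antisym _ _ _ (index^~ es)) => [e f /sT ? /sT ?|e f eT fT ef].
  exact: index_edge_inj.
have DC : T :\ e :\ f = T :\ f :\ e by rewrite !setDDl setUC.
have De : T :\ f = e |: (T :\ e :\ f) by rewrite DC setD1K // !inE ef.
have Df : T :\ e = f |: (T :\ e :\ f) by rewrite setD1K // !inE eq_sym ef.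
rewrite /h -DC -scaleNr; congr (_ *: _).
have [eD fD] : e \notin T :\ e :\ f /\ f \notin T :\ e :\ f.
  by rewrite !inE !eqxx andbF.
rewrite {1}Df De !incidence_signU1 //.
(* Exactly one of [e], [f] precedes the other, so the two sign products are opposite. *)
have : index e es != index f es by rewrite (inj_in_eq index_edge_inj) ?sT.
by case: ltngtP => //= _ _; rewrite !expr0 !expr1 !mul1r ?mulN1r ?mulNr ?opprK mulrC.
Qed.

(** * Active edges and the toggling homotopy *)

Definition from k S : {set {set G}} := [set f in S | (k <= index f es)%N].

(** Indices start at 0; the [k]-th edge itself may or may not lie in [S]. *)
Definition active S k : Prop := redundant (from k.+1 S) (nth set0 es k).

Definition idle k S : Prop := forall j, (j < k)%N -> ~ active S j.

Lemma fromS k S T : S \subset T -> from k S \subset from k T.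
Proof. by move=> /subsetP sST; apply/subsetP=> f; rewrite !inE => /andP[/sST-> ->]. Qed.

Lemma activeS k S T : S \subset T -> active S k -> active T k.
Proof. by move=> sST; apply/redundantS/fromS. Qed.

Lemma idleS k S T : S \subset T -> idle k T -> idle k S.
Proof. by move=> sST iT j /iT nT /(activeS _ _ _ sST). Qed.

Lemma from_sub k S : from k S \subset S.
Proof. by apply/subsetP=> f; rewrite inE => /andP[]. Qed.

Lemma from_leq k l S : (k <= l)%N -> from l S \subset from k S.
Proof.
move=> kl; apply/subsetP=> f; rewrite !inE => /andP[-> /=].
exact: leq_trans.
Qed.

Lemma from_nth k S : (k < size es)%N ->
  from k.+1 (S :\ nth set0 es k) = from k.+1 S.
Proof.
have [ues _] := es_ordering; move=> ks; apply/setP=> f; rewrite !inE.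
by case: eqP => [->|//]; rewrite index_uniq // ltnn !andbF.
Qed.

Lemma active_redundant k S : active S k -> redundant S (nth set0 es k).
Proof. exact/redundantS/from_sub. Qed.

(** A path that uses the new edge can be rerouted through edges of [S] after position [k], hence
    after every [j < k]; so no earlier edge becomes active. *)
Lemma idleU1 k S : active S k -> idle k S -> idle k (nth set0 es k |: S).
Proof.
move=> aS iS j jk aj; apply: (iS j jk) => u v /aj; apply: connect_sub => x y.
rewrite [adj _ _ _]inE => /andP[/setU1P[/esym exy _|xyS xyj]]; last first.
  by apply: connect1; rewrite /adj inE xyS.
by have := redundantS _ _ _ (from_leq _ _ S (ltnW jk : (j.+1 <= k.+1)%N)) aS; apply.
Qed.

Lemma diff_exact k x : (k <= size es)%N ->
    (forall T, T \subset edges G -> diff x T = 0) ->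
    (forall S, S \subset edges G -> idle k S -> x S = 0) ->
  exists y, forall T, T \subset edges G -> diff y T = x T.
Proof.
have [ues esE] := es_ordering.
elim: k x => [|k IHk] x ks dx0 x0.
  exists (fun=> 0) => T sT; rewrite (x0 T) // /diff big1 // => e _.
  by rewrite linear0 scaler0.
pose e := nth set0 es k.
have eE : e \in edges G by rewrite -esE mem_nth.
(* The homotopy: [x] is pulled back along the toggled edge. [m] runs against the inclusion here, as
   the inverse of the structure map. *)
pose y S : F S :=
  if `[< [/\ idle k S, active S k & e \notin S] >]
  then sgn S e *: m (e |: S) S (x (e |: S)) else 0.
pose z S := x S - diff y S.
have dz0 T : T \subset edges G -> diff z T = 0.
  by move=> sT; rewrite diffB dx0 // diff_diff // subr0.
(* Here [x S] vanishes by hypothesis, and so does [y] on every subset of [S], where the [k]-th edge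
   is not active either. *)
have z0_nonactive S : S \subset edges G -> idle k S -> ~ active S k -> z S = 0.
  move=> sS iS nS; rewrite /z (x0 S) // => [|j]; last first.
    by rewrite ltnS leq_eqVlt => /predU1P[->|/iS].
  rewrite /diff big1 ?subr0 // => f fS; rewrite /y asboolF ?linear0 ?scaler0 //.
  by case=> _ /(activeS _ _ _ (subD1set _ _)).
(* Among the sets [S :\ f] only [S :\ e] avoids [e], so [diff y S] reduces to one term, equal to
   [x S]. *)
have z0_mem S : S \subset edges G -> idle k S -> active S k -> e \in S -> z S = 0.
  move=> sS iS aS eS; rewrite /z /diff (bigD1 e) //= big1 ?addr0; last first.
    move=> f /andP[fS fe]; rewrite /y asboolF ?linear0 ?scaler0 //.
    by case=> _ _; rewrite !inE eS eq_sym fe.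
  have aD : active (S :\ e) k by rewrite /active from_nth.
  rewrite /y asboolT; last by split; rewrite ?setD11 //; apply: idleS iS; apply: subD1set.
  have eqc : comps S = comps (S :\ e).
    by rewrite -[S in LHS](setD1K eS) comps_redundant //; apply: active_redundant.
  by rewrite setD1K // (linearZZ (m _ _)) scalerA incidence_sign_sqr scale1r mK ?subrr.
have z0 S : S \subset edges G -> idle k S -> z S = 0.
  move=> sS iS; have [aS|] := pselect (active S k); last exact: z0_nonactive.
  have [|eS] := boolP (e \in S); first exact: z0_mem.
  have sU : e |: S \subset edges G by rewrite subUset sub1set eE.
  have iU : idle k (e |: S) by apply: idleU1.
  have eqc : comps S = comps (e |: S) by rewrite comps_redundant //; apply: active_redundant.
  (* In the cocycle equation at [e |: S] every other term is already known to vanish; the remaining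
     one is an invertible image of [z S]. *)
  have := dz0 _ sU; rewrite /diff (bigD1 e) ?setU11 //= big1 ?addr0; last first.
    move=> f /andP[fU fe]; have sD : (e |: S) :\ f \subset e |: S by apply: subD1set.
    have iD := idleS _ _ _ sD iU; have sDE := subset_trans sD sU.
    suff -> : z ((e |: S) :\ f) = 0 by rewrite linear0 scaler0.
    have [aD|] := pselect (active ((e |: S) :\ f) k); last exact: z0_nonactive.
    by apply: z0_mem; rewrite // !inE eqxx eq_sym fe.
  rewrite setU1K // => /(congr1 (fun t => m (e |: S) S (sgn S e *: t))).
  by rewrite scalerA incidence_sign_sqr scale1r mK // scaler0 linear0.
have [u du] := IHk z (ltnW ks) dz0 z0.
(* This is [u + y], written as a difference so that [diffB] applies. *)
exists (fun S => u S - - y S) => T sT; rewrite diffB du //.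
have -> : diff (fun S => - y S) T = - diff y T.
  by rewrite /diff -sumrN; apply: eq_bigr => f _; rewrite linearN scalerN.
by rewrite opprK subrK.
Qed.

(** Insert the edges of [S] from last to first: as none is active, each one joins two distinct
    components of the later ones. *)
Lemma card_comps_from k S : S \subset edges G -> idle (size es) S ->
  (k <= size es)%N -> (#|comps (from k S)| + #|from k S| <= #|G|)%N.
Proof.
have [ues esE] := es_ordering => sS iS.
(* The induction is on the number [d] of positions from [k] on, so [k] descends from [size es]. *)
move=> /subnKC; move: (size es - k)%N => d; elim: d k => [|d IHd] k.
  rewrite addn0 => ks; have -> : from k S = set0.
    apply/setP=> f; rewrite !inE ks; case fS: (f \in S) => //=.
    by rewrite leqNgt index_mem esE (subsetP sS).
  by rewrite cards0 addn0 (leq_trans (leq_imset_card _ _)) // cardsT.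
rewrite addnS -addSn => kd; have ks : (k < size es)%N by rewrite -kd ltnS leq_addr.
set e := nth set0 es k; have eE : e \in edges G by rewrite -esE mem_nth.
have iE f : f \in S -> (k <= index f es)%N = (f == e) || (k < index f es)%N.
  move=> fS; rewrite leq_eqVlt; congr orb; rewrite eq_sym -(index_uniq set0 ks ues).
  by rewrite (inj_in_eq index_edge_inj) // (subsetP sS).
have {IHd} := IHd k.+1 kd; have [eS|eS] := boolP (e \in S); last first.
  suff -> : from k S = from k.+1 S by [].
  apply/setP=> f; rewrite !inE; case fS: (f \in S) => //=; rewrite iE //.
  by case: eqP fS eS => //= -> ->.
have fE : from k S = e |: from k.+1 S.
  apply/setP=> f; rewrite !inE; case fS: (f \in S) => /=; first by rewrite iE.
  by case: eqP fS eS => //= -> ->.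
have efrom : e \notin from k.+1 S by rewrite inE index_uniq // ltnn andbF.
rewrite fE cardsU1 efrom addnCA add1n -addSn; apply: leq_trans; rewrite leq_add2r.
have : ~ active S k by apply: iS.
move=> /existsNP[u /existsNP[v /not_implyP[euv /negP nuv]]].
by rewrite /e euv ltn_comps.
Qed.

Lemma idle_card S : (0 < #|G|)%N -> S \subset edges G -> idle (size es) S ->
  (#|S| < #|G|)%N.
Proof.
move=> /card_gt0P[v _] sS iS; have := card_comps_from 0%N _ sS iS (leq0n _).
have -> : from 0 S = S by apply/setP=> f; rewrite inE andbT.
apply: leq_trans; rewrite -add1n leq_add2r -card_component; apply/card_gt0P.
by exists (comp_of S v).
Qed.

End BooleanLatticeComplex.

(** * Transfer to the chromatic complex *)

Lemma dirsum0E {R : pzRingType} {I : finType} {M : I -> lmodType R} (i : I) :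
  (0 : dirsum M) i = 0.
Proof. exact: ds_mkE. Qed.

Section ChromaticComplex.
Variables (R A : comPzRingType) (phi : {rmorphism R -> A}).
Variables (G : finite_graph) (es : seq {set G}).
Hypothesis es_ordering : edge_ordering es.
Implicit Types (S T U : {set {set G}}) (e : {set G}).

Lemma chromF_map_comp S T U x : S \subset T -> T \subset U ->
  chromF_map phi T U (chromF_map phi S T x) = chromF_map phi S U x.
Proof.
move=> sST sTU; rewrite /chromF_map /= tmul_comp; apply: eq_tmul => c /=.
exact: merge_comp_comp.
Qed.

Lemma chromF_mapK S T : comps S = comps T ->
  cancel (chromF_map phi S T) (chromF_map phi T S).
Proof.
move=> eST x; rewrite /chromF_map /= tmul_comp; apply: tmul_id.
exact: merge_compK.
Qed.

Lemma chromF_map_id S x : chromF_map phi S S x = x.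
Proof. by rewrite /chromF_map /= tmul_id // => c; apply/val_inj/merge_comp_id. Qed.

Local Notation diff := (diff R G es (@chromF R A phi G) (@chromF_map R A phi G)).

(* A cochain as a family over all edge sets; the sum has at most one term, in *)
(* which chromF_map is the identity, and stands for a cast along val B = S. *)
Definition extend {k : int} (x : cochains phi G k) S : chromF phi S :=
  \sum_(B : cells G k | val B == S) chromF_map phi (val B) S (x B).

Lemma extend_val {k : int} (x : cochains phi G k) B : extend x (val B) = x B.
Proof.
by rewrite /extend (big_pred1 B) ?chromF_map_id // => C; apply: inj_eq val_inj.
Qed.

Lemma extend_eq0 {k : int} (x : cochains phi G k) S :
  ~~ ((S \subset edges G) && (#|S|%:Z == k)) -> extend x S = 0.
Proof.
move=> nS; rewrite /extend big_pred0 // => B.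
by apply: contraNF nS => /eqP <-; apply: valP B.
Qed.

(** A pair of a cell [B] and an edge [e] outside it with union [D] amounts to an element [e] of [D].
    When [l] is not [k + 1] both sides vanish. *)
Lemma delta_diff {k l : int} (x : cochains phi G k) (D : cells G l) :
  delta es l x D = diff (extend x) (val D).
Proof.
rewrite ds_mkE /diff.
under [RHS]eq_bigr do rewrite (linear_sum (chromF_map phi _ _)) scaler_sumr.
rewrite [RHS](exchange_big_dep predT) //; apply: eq_bigr => B _.
apply: eq_big => [e|e /andP[eB /eqP->]].
  apply/andP/andP => [[eB /eqP->]|[eD /eqP->]].
    by rewrite setU11 setU1K.
  by rewrite setD11 setD1K.
by rewrite setU1K // chromF_map_id.
Qed.

Lemma cocycle_coboundary (k : int) (x : cochains phi G k) :
    (0 < #|G|)%N -> #|G|%:Z <= k -> delta es (k + 1) x = 0 ->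
  exists y, delta es k (y : cochains phi G (k - 1)) = x.
Proof.
move=> G0 Gk dx.
have cardD T e : e \in T -> #|T :\ e|%:Z = #|T|%:Z - 1.
  by move=> eT; rewrite (cardsD1 e T) eT add1n -addn1 PoszD addrK.
have dX T : T \subset edges G -> diff (extend x) T = 0.
  (* Outside degree [k + 1] no set [T :\ e] has [k] elements, so all terms are zero. *)
  move=> sT; have [Tk|Tk] := eqVneq #|T|%:Z (k + 1).
    have [D <-] : exists D : cells G (k + 1), val D = T.
      have cT : (T \subset edges G) && (#|T|%:Z == k + 1) by rewrite sT Tk eqxx.
      by exists (Sub T cT); rewrite SubK.
    by rewrite -delta_diff dx dirsum0E.
  rewrite /diff big1 // => e eT; rewrite extend_eq0 ?linear0 ?scaler0 //.
  by rewrite cardD // subr_eq (negPf Tk) andbF.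
have X0 S : S \subset edges G -> idle G es (size es) S -> extend x S = 0.
  move=> sS iS; rewrite extend_eq0 // sS /=.
  have := idle_card G es es_ordering S G0 sS iS; rewrite -ltz_nat => /lt_le_trans/(_ Gk).
  by rewrite lt_neqAle => /andP[].
have [y dy] := diff_exact _ _ _ es_ordering _ _ chromF_map_comp chromF_mapK
  _ _ (leqnn _) dX X0.
(* The primitive lives in all degrees; only its part in degree [k - 1] contributes to sets of size
   [k]. *)
exists (ds_mk (fun B : cells G (k - 1) => y (val B))); apply: dsP => D.
rewrite delta_diff -extend_val -dy; last by case/andP: (valP D).
apply: eq_bigr => e eD; congr (_ *: chromF_map phi _ _ _).
have cD : (val D :\ e \subset edges G) && (#|val D :\ e|%:Z == k - 1).
  case/andP: (valP D) => sD /eqP cD; rewrite cardD // cD eqxx andbT.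
  exact: subset_trans (subD1set _ _) sD.
have [B <-] : exists B : cells G (k - 1), val B = val D :\ e.
  by exists (Sub (val D :\ e) cD); rewrite SubK.
by rewrite extend_val ds_mkE.
Qed.

End ChromaticComplex.

(** * Vanishing of the homology *)

Lemma cohomology_eq0 (R : pzRingType) (U V W : lmodType R)
    (f : {linear U -> V}) (g : {linear V -> W}) :
  (forall x, g x = 0 -> exists u, f u = x) -> forall x : cohomology f g, x = 0.
Proof.
move=> ex x; elim/cohomologyW: x => x.
have [u fu] : exists u, f u = val x by apply/ex/eqP; apply: valP x.
rewrite -[RHS](raddf0 (\pi_(cohomology f g)%qT)).
apply/eqP; rewrite -Quotient.idealrBE subr0.
by apply/asboolP; exists u.
Qed.

Theorem corollary5p11 (R A : comPzRingType) (phi : {rmorphism R -> A})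
    (Agr : int -> submodClosed (algmod phi))
    (A_graded : is_graded_algebra Agr)
    (A_free : forall j : int, free_of_finite_rank (Agr j))
    (G : finite_graph) (G_connected : connected_graph G)
    (es : seq {set G}) (es_ordering : edge_ordering es)
    (n : nat) (n_vertices : #|vertex G| = n) (i : int) :
  ~ (0 <= i <= n%:Z - 1) ->
  forall x : chromatic_homology phi es i, x = 0.
Proof.
move=> ni; apply: cohomology_eq0 => x dx.
have [i0|i0] := leP 0 i; last first.
  (* In negative degree there are no cells, so every cochain is zero. *)
  exists 0; apply: dsP => B; case/andP: (valP B) => _ /eqP cB.
  by have : #|val B|%:Z < 0 by rewrite cB.
apply: cocycle_coboundary => //.
  (* Connectedness asks for exactly one component, while an empty vertex set has none. *)
  rewrite lt0n; apply: contraTneq G_connected => /card0_eq V0; rewrite /connected_graph.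
  suff /eqP-> : #|comps (edges G)| == 0 by [].
  rewrite -card_component; apply/eqP/eq_card0 => c; have [v _] := comp_inhabited c.
  by have := V0 v.
have -> : #|G| = n by [].
by move/negP: ni; rewrite i0 -ltNge /= ltrBlDr ltzD1.
Qed.
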